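(* Let $q=p^r$ be a power of a prime $p$ and let $n\ge 2$ be an integer. Then \[ \bar{I}_q(n,0,0)=\frac1n\sum_{d\mid n,\ p\nmid d}\mu(d)\left(F_q(n/d,0,0)-[p\mid n]\,q^{n/(pd)}\right). \]
   Context: $\mathbb{F}_q$ denotes the finite field with $q$ elements. For $a\in\mathbb{F}_{q^m}$ put $\mathrm{Tr}(a)=\sum_{i=0}^{m-1}a^{q^i}$ and $\mathrm{rTr}(a)=\sum_{i=0}^{m-1}a^{-q^i}$, where for $a=0$ this is taken to be $0$ (convention $0^{-1}=0$). For $\gamma_1,\gamma_2\in\mathbb{F}_q$, $F_q(m,\gamma_1,\gamma_2)$ denotes the number of $a\in\mathbb{F}_{q^m}$ with $\mathrm{Tr}(a)=\gamma_1$ and $\mathrm{rTr}(a)=\gamma_2$. $\bar{I}_q(n,0,0)$ denotes the number of monic irreducible polynomials of degree $n$ in $\mathbb{F}_q[x]$ whose coefficients of $x^{n-1}$ and of $x$ are both $0$. $\mu$ is the Möbius function, and $[p\mid n]$ equals $1$ if $p$ divides $n$ and $0$ otherwise. *)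

(* Defs.v *)
From HB Require Import structures.
From mathcomp Require Import all_boot all_order all_algebra all_fingroup.
From mathcomp Require Import all_solvable all_field.

Set Implicit Arguments.
Unset Strict Implicit.
Unset Printing Implicit Defensive.

Import GRing.Theory FinRing.Theory.
Local Open Scope ring_scope.

Lemma finExt_exists (F : finFieldType) (m : nat) : (0 < m)%N ->
  {L : fieldExtType F | #|finvect_type L| = (#|F| ^ m)%N}.
Proof.
move=> m_gt0; set Q := (#|F| ^ m)%N.
have F_gt1 : (1 < #|F|)%N by apply: finNzRing_gt1.
have Q_gt1 : (1 < Q)%N by rewrite /Q -(expn0 #|F|) ltn_exp2l.
have Q1_gt0 : (0 < Q.-1)%N by rewrite -ltnS prednK // ltnW.
pose P (R : nzRingType) : {poly R} := 'X^Q - 'X.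
have DP (R : nzRingType) : P R = ('X^(Q.-1) - 1) * ('X - 0).
  by rewrite subr0 mulrBl mul1r -exprSr prednK // ltnW.
have /FinSplittingFieldFor[/= L splitLP] : P F != 0.
  by rewrite DP monic_neq0 ?rpredM ?monicXsubC ?monicXnsubC.
rewrite [map_poly _ _]rmorphB rmorphXn /= map_polyX -/(P L) in splitLP.
exists L.
have /finField_galois_generator[/= a _ Da] : (1 <= {:L})%VS by apply: sub1v.
rewrite dimv1 expn1 in Da.
pose E := fixedSpace (a ^+ m)%g.
have [zs DPL defL] := splitLP.
have QL0 : Q%:R = 0 :> L.
  have F0 : #|F|%:R = 0 :> F.
    by rewrite -zmodXgE -cardsT expg_cardG ?inE.
  rewrite /Q natrX -(rmorph_nat (in_alg L)) F0 rmorph0 expr0n.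
  by rewrite gtn_eqF.
have Uzs : uniq zs.
  rewrite -separable_prod_XsubC -(eqp_separable DPL) DP separable_root andbC.
  rewrite /root !hornerE subr_eq0 eq_sym expr0n gtn_eqF ?oner_eq0 //=.
  rewrite cyclotomic.separable_Xn_sub_1 // -subn1 natrB ?(ltnW Q_gt1) //.
  by rewrite QL0 sub0r oppr_eq0 oner_eq0.
have in_zs : zs =i E.
  move=> z; rewrite -root_prod_XsubC -(eqp_root DPL) (sameP fixedSpaceP eqP).
  rewrite /root !hornerE subr_eq0 /= /Q; congr (_ == z).
  elim: (m) => [|i IHi]; first by rewrite gal_id.
  by rewrite expgSr expnSr exprM IHi galM ?Da ?memvf.
have defE : E = {:L}%VS.
  apply/eqP; rewrite eqEsubv subvf -defL -[E]subfield_closed agenvS //.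
  by rewrite subv_add sub1v; apply/span_subvP=> z; rewrite in_zs.
have /eq_card-> : finvect_type L =i zs by move=> z; rewrite in_zs defE memvf.
apply: succn_inj; rewrite (card_uniqP _) //= -(size_prod_XsubC _ id).
by rewrite -(eqp_size DPL) size_polyDl size_polyXn // size_polyN size_polyX.
Qed.

(* The field with q^m elements over F, q = #|F|; at the meaningless value
   m = 0 it has degree 1. *)
Definition finExt (F : finFieldType) (m : nat) : fieldExtType F :=
  sval (finExt_exists F (ltn0Sn m.-1)).

Lemma card_finExt (F : finFieldType) (m : nat) : (0 < m)%N ->
  #|finvect_type (finExt F m)| = (#|F| ^ m)%N.
Proof. by move=> m_gt0; rewrite /finExt; case: finExt_exists => L /= ->; rewrite prednK. Qed.

Definition Tr (F : finFieldType) (m : nat) (a : finExt F m) : finExt F m :=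
  \sum_(i < m) a ^+ (#|F| ^ i).

(* The convention 0^-1 = 0 is that of fieldType (invr0). *)
Definition rTr (F : finFieldType) (m : nat) (a : finExt F m) : finExt F m :=
  \sum_(i < m) a ^- (#|F| ^ i).

Definition Fcount (F : finFieldType) (m : nat) (g1 g2 : F) : nat :=
  #|[set a : finvect_type (finExt F m) | (Tr a == g1%:A) && (rTr a == g2%:A)]|.

Definition Ibar00 (F : finFieldType) (n : nat) : nat :=
  #|[set f : {poly_n.+1 F} |
      [&& size f == n.+1, (f : {poly F}) \is monic, irreducibleb f,
          f`_n.-1 == 0 & f`_1 == 0]]|.

Definition moebius (d : nat) : int :=
  if all (fun l => logn l d == 1)%N (primes d) then (-1) ^+ size (primes d)
  else 0.

(* Main.v *)
From HB Require Import structures.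
Require Import Defs.
From mathcomp Require Import all_boot all_order all_algebra all_fingroup.
From mathcomp Require Import all_solvable all_field.

Set Implicit Arguments.
Unset Strict Implicit.
Unset Printing Implicit Defensive.

Import GRing.Theory.
Local Open Scope ring_scope.

(** Let L be the extension of degree m of F, with q = #|F|. An element a of L
    whose orbit under the Frobenius map x |-> x^q has d elements has minimal
    polynomial \prod_(x in orbit) ('X - x), of degree d | m, and every monic
    irreducible f of degree d | m arises from exactly d elements, since it
    divides 'X^(q^m) - 'X. Both Tr a and rTr a are m/d times a sum over the
    orbit, and these orbit sums are, up to a nonzero factor, the coefficients
    of degree d-1 and 1 of f. So a is counted by F_q(m,0,0) iff p | m/d or both
    coefficients vanish. As p | m/d iff d | m/p, the elements of the first kind
    are q^(m/p) in number if p | m (and there are none otherwise), whence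
      F_q(m,0,0) - [p | m] q^(m/p) = \sum_(d | m, p not dividing m/d) E(d),
    where E(d) counts the elements of degree d of the second kind. Moebius
    inversion over the quotients m/d prime to p gives E(n) = n Ibar_q(n,0,0). *)

(** * Periods of points, and irreducible factors of ['X^(q^N) - 'X] *)

Lemma order_dvdn_iter (T : finType) (f : T -> T) (x : T) (m : nat) :
  iter m f x = x -> (fingraph.order f x %| m)%N.
Proof.
case: m => [|m] fm; first exact: dvdn0.
have fo : iter (fingraph.order f x) f x = x.
  (* Items 3 and 4 of [orbitPcycle]: a point fixed by some positive iterate is fixed by the iterate
     of index [order]. *)
  by apply/(orbitPcycle 3 4); exists m; exact: fm.
set d := fingraph.order f x in fo *; rewrite /dvdn.
have fr : iter (m.+1 %% d) f x = x.
  rewrite -[RHS]fm [in RHS](divn_eq m.+1 d) addnC iterD; congr (iter _ f _).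
  by elim: (_ %/ d)%N => // k IH; rewrite mulSn iterD -IH fo.
have lt_d : (m.+1 %% d < d)%N by rewrite ltn_pmod ?fingraph.order_gt0.
by rewrite -(findex_iter lt_d) fr findex0.
Qed.

(** The class of ['X] lies in the field [F[X]/(f)] with [q^(deg f)] elements, so raising it to that
    power, [k] times over, fixes it. *)
Lemma irreducible_dvdp_Xn_subX (F : finFieldType) (f : {poly F}) (k : nat) :
  irreducible_poly f -> f \is monic ->
  f %| 'X^(#|F| ^ ((size f).-1 * k)) - 'X.
Proof.
move=> f_irr f_mon; pose hI : monic_irreducible_poly f := (f_irr, f_mon).
pose qT := {poly %/ f with hI}.
have XN : (in_qpoly f 'X : qT) ^+ (#|F| ^ ((size f).-1 * k)) = in_qpoly f 'X.
  elim: k => [|k IH]; first by rewrite muln0 expn0 expr1.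
  by rewrite mulnS expnD exprM -(card_qfpoly hI) expf_card IH.
have: in_qpoly f ('X^(#|F| ^ ((size f).-1 * k)) - 'X) == 0.
  by rewrite rmorphB rmorphXn subr_eq0; apply/eqP.
move=> /eqP/val_eqP /=.
by rewrite -Pdiv.IdomainMonic.modpE ?mk_monicE.
Qed.

(** * Frobenius orbits and minimal polynomials over [F] *)

Section Frobenius.

Variables (F L : finFieldType) (iota : {rmorphism F -> L}).

(* [iota] is a phantom argument: the ring morphism instance below needs it to
   compare the characteristics of [F] and [L]. *)
Definition frob & {rmorphism F -> L} := fun x : L => x ^+ #|F|.
Local Notation fr := (frob iota).

Lemma pchar_nat_card : [pchar L].-nat #|F|.
Proof.
have [p p_pr pF] := finPcharP F.
have pL : p \in [pchar L] by rewrite (fmorph_pchar iota).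
rewrite -cardsT (sub_in_pnat _ (abelem_pgroup (fin_ring_pchar_abelem pF))) //.
by move=> x _ /eqP->.
Qed.

Fact frob_zmod : zmod_morphism fr.
Proof.
move=> x y; apply/(addIr (fr y)); rewrite subrK /frob -exprDn_pchar ?subrK //.
exact: pchar_nat_card.
Qed.

Fact frob_monoid : monoid_morphism fr.
Proof. by split=> [|x y]; rewrite /frob ?expr1n ?exprMn. Qed.

HB.instance Definition _ := GRing.isZmodMorphism.Build L L fr frob_zmod.
HB.instance Definition _ := GRing.isMonoidMorphism.Build L L fr frob_monoid.

Lemma frob_inj : injective fr. Proof. exact: fmorph_inj. Qed.

Lemma iter_frob i x : iter i fr x = x ^+ (#|F| ^ i).
Proof. by elim: i => //= i ->; rewrite /frob -exprM -expnSr. Qed.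

Lemma frob_scalar c : fr (iota c) = iota c.
Proof. by rewrite /frob -rmorphXn expf_card. Qed.

(** ['X^#|F| - 'X] is the product of all ['X - c] over [F], so its roots in [L] are the images of
    these [c]. *)
Lemma frob_fixed x : fr x = x -> exists c, x = iota c.
Proof.
move=> fx; have := congr1 (map_poly iota) (finField_genPoly F).
rewrite map_prod_XsubC rmorphB /= map_polyXn map_polyX => Dg.
have: root ('X^#|F| - 'X : {poly L}) x.
  by rewrite /root !hornerE -[x ^+ _]/(fr x) fx subrr.
rewrite Dg -big_enum -(big_map iota xpredT (fun y => 'X - y%:P)).
by rewrite root_prod_XsubC => /mapP[c _ ->]; exists c.
Qed.

Lemma frob_root (f : {poly F}) x :
  root (map_poly iota f) x -> root (map_poly iota f) (fr x).
Proof.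
move=> /rootP fx0; have Df : map_poly fr (map_poly iota f) = map_poly iota f.
  by apply/polyP=> i; rewrite !coef_map /= frob_scalar.
by rewrite /root -{1}Df horner_map fx0 rmorph0.
Qed.

Definition orbit_poly (a : L) := \prod_(x <- fingraph.orbit fr a) ('X - x%:P).

(** Frobenius is injective, hence permutes the roots. *)
Lemma map_frob_orbit_poly a : map_poly fr (orbit_poly a) = orbit_poly a.
Proof.
rewrite /orbit_poly map_prod_XsubC -(big_map fr xpredT (fun x => 'X - x%:P)).
apply: perm_big; apply: uniq_perm;
  rewrite ?(map_inj_uniq frob_inj) ?orbit_uniq //.
have sub: {subset map fr (fingraph.orbit fr a) <= fingraph.orbit fr a}.
  by move=> _ /mapP[x xo ->]; apply: fingraph.mem_orbit.
have [] // := uniq_min_size _ sub; last by rewrite size_map.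
by rewrite (map_inj_uniq frob_inj) orbit_uniq.
Qed.

(** The minimal polynomial of [a], pulled back to [F] coefficient by coefficient; the default 0 is
    never taken, since Frobenius fixes the coefficients of [orbit_poly a]. *)
Definition minp (a : L) : {poly F} :=
  \poly_(i < size (orbit_poly a))
    odflt 0 [pick c | iota c == (orbit_poly a)`_i].

Lemma map_minp a : map_poly iota (minp a) = orbit_poly a.
Proof.
apply/polyP=> i; rewrite coef_map coef_poly.
case: ltnP => [_|?]; last by rewrite /= rmorph0 nth_default.
have [|c Dc] := frob_fixed (x := (orbit_poly a)`_i).
  by rewrite -[in LHS]coef_map map_frob_orbit_poly.
by case: pickP => [b /eqP // | /(_ c)/eqP[]].
Qed.

Lemma size_minp a : size (minp a) = (fingraph.order fr a).+1.
Proof. by rewrite -(size_map_poly iota) map_minp size_prod_XsubC size_orbit. Qed.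

Lemma monic_minp a : minp a \is monic.
Proof. by rewrite -(map_monic iota) map_minp monic_prod_XsubC. Qed.

Lemma root_minp a x :
  root (map_poly iota (minp a)) x = (x \in fingraph.orbit fr a).
Proof. by rewrite map_minp root_prod_XsubC. Qed.

(** Frobenius carries roots of [f] to roots, so [f] vanishes on the whole orbit, whose elements are
    distinct. *)
Lemma minp_dvdp a (f : {poly F}) : (minp a %| f) = root (map_poly iota f) a.
Proof.
apply/idP/idP => [mf|fa].
  have: root (map_poly iota (minp a)) a by rewrite root_minp in_orbit.
  by rewrite -!dvdp_XsubCl => /dvdp_trans; apply; rewrite dvdp_map.
rewrite -(dvdp_map iota) map_minp uniq_roots_dvdp ?uniq_rootsE ?orbit_uniq //.
apply/allP=> x; rewrite -fconnect_orbit => /iter_findex <-.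
by elim: (findex _ _ _) => //= i /frob_root.
Qed.

Lemma irreducible_minp a : irreducible_poly (minp a).
Proof.
split=> [|f sf fa]; first by rewrite size_minp ltnS fingraph.order_gt0.
have /dvdpP[g Dm] := fa.
have: root (map_poly iota (minp a)) a by rewrite root_minp in_orbit.
rewrite Dm rmorphM rootM -!minp_dvdp => /orP[ag|]; last first.
  by rewrite -Dm /eqp fa => ->.
have m0 : minp a != 0 by rewrite monic_neq0 ?monic_minp.
have [g0 f0] : g != 0 /\ f != 0.
  by apply/andP; rewrite -negb_or -mulf_eq0 -Dm.
(* Here [minp a] divides its own cofactor [g]; comparing degrees makes [f] constant, against
   [sf]. *)
have := dvdp_leq g0 ag; rewrite Dm size_mul // (polySpred f0) addnS /=.
rewrite -{2}[size g]addn0 leq_add2l leqn0 => /eqP f1.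
by rewrite (polySpred f0) f1 in sf.
Qed.

Lemma eq_minp (f : {poly F}) a : irreducible_poly f -> f \is monic ->
  root (map_poly iota f) a -> f = minp a.
Proof.
move=> [_ f_irr] f_mon; rewrite -minp_dvdp => fa.
apply/esym/eqP; rewrite -eqp_monic ?monic_minp // f_irr //.
by rewrite size_minp eqSS -lt0n fingraph.order_gt0.
Qed.

Lemma minp_eq a b : (minp b == minp a) = (b \in fingraph.orbit fr a).
Proof.
rewrite -root_minp; apply/eqP/idP => [<-|/eq_minp-> //].
- by rewrite root_minp in_orbit.
- exact: irreducible_minp.
exact: monic_minp.
Qed.

Variable m : nat.
Hypothesis cardL : #|L| = (#|F| ^ m)%N.

Lemma frob_order_dvd a : (fingraph.order fr a %| m)%N.
Proof. by apply: order_dvdn_iter; rewrite iter_frob -cardL expf_card. Qed.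

(** [f] divides ['X^#|L| - 'X], a product of linear factors over [L]; being nonconstant, it has a
    root there. *)
Lemma irreducible_eq_minp (f : {poly F}) : irreducible_poly f ->
  f \is monic -> ((size f).-1 %| m)%N -> exists a, f = minp a.
Proof.
move=> f_irr f_mon /dvdnP[k Dm].
have := irreducible_dvdp_Xn_subX k f_irr f_mon.
rewrite mulnC -Dm -(dvdp_map iota) rmorphB /= map_polyXn map_polyX -cardL.
rewrite finField_genPoly -big_enum => /dvdp_prod_XsubC[ms].
set s := mask _ _ => eq_fs.
case Ds: s => [|a s'].
  have := f_irr.1; rewrite -(size_map_poly iota) (eqp_size eq_fs).
  by rewrite size_prod_XsubC Ds.
exists a; apply: eq_minp => //.
by rewrite (eqp_root eq_fs) root_prod_XsubC Ds mem_head.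
Qed.

(** The fibres of [minp] are Frobenius orbits, so each admissible polynomial comes from exactly [d]
    elements. *)
Lemma card_minp_pred (d : nat) (Q : pred {poly F}) : (d %| m)%N ->
  #|[set a : L | (fingraph.order fr a == d) && Q (minp a)]| =
  (d * #|[set f : {poly_d.+1 F} |
      [&& size f == d.+1, (f : {poly F}) \is monic, irreducibleb f & Q f]]|)%N.
Proof.
move=> dm; set A := [set a | _]; set B := [set f | _].
(* The truncation is harmless on [A], where [minp a] has size [d.+1]. *)
pose g a := npolyp d.+1 (minp a).
have gE a : a \in A -> g a = minp a :> {poly F}.
  by rewrite inE => /andP[/eqP Dd _]; rewrite npolypK // size_minp Dd.
have gB a : a \in A -> g a \in B.
  move=> aA; rewrite inE gE //; move: aA; rewrite inE => /andP[/eqP Dd ->].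
  by rewrite size_minp Dd eqxx monic_minp (introT (irreducibleP _)) //;
     apply: irreducible_minp.
rewrite -sum1_card (partition_big g (fun f => f \in B)) //=.
rewrite mulnC -sum_nat_const.
apply: eq_bigr => f; rewrite inE.
case/and4P=> /eqP sf f_mon /irreducibleP f_irr Qf.
have [|a Df] := irreducible_eq_minp f_irr f_mon; first by rewrite sf.
have oa : fingraph.order fr a = d by have := size_minp a; rewrite -Df sf => -[].
rewrite sum1_card -[RHS]oa -size_orbit -(card_uniqP (orbit_uniq _ _)).
apply: eq_card => b; rewrite -minp_eq -Df [LHS]unfold_in /=.
apply/andP/eqP => [[/gE <- /eqP -> //]|Dm].
have bA : b \in A.
  by rewrite inE Dm Qf -oa -eqSS -!size_minp Dm Df eqxx.
by rewrite bA -val_eqE /= gE ?Dm.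
Qed.

End Frobenius.

(** * Moebius function and inversion away from [p] *)

Lemma moebius_eq0 (l d : nat) : (1 < logn l d)%N -> moebius d = 0.
Proof.
move=> l2; rewrite /moebius; case: allP => // /(_ l).
have l_d : l \in primes d by rewrite -logn_gt0 ltnW.
by move=> /(_ l_d)/eqP ld; rewrite ld in l2.
Qed.

Lemma moebius_mul_prime (l d : nat) : prime l -> (0 < d)%N -> ~~ (l %| d)%N ->
  moebius (l * d) = - moebius d.
Proof.
move=> l_pr d0 ld.
have perm_pr : perm_eq (primes (l * d)) (l :: primes d).
  apply: uniq_perm => [||x]; first exact: primes_uniq.
    by rewrite /= primes_uniq mem_primes (negPf ld) !andbF.
  by rewrite primesM ?(prime_gt0 l_pr) // primes_prime // !inE.
have ldl : logn l d = 0%N by rewrite lognE (negPf ld) !andbF.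
rewrite /moebius (perm_all _ perm_pr) (perm_size perm_pr) /=.
rewrite lognM ?(prime_gt0 l_pr) // logn_prime // eqxx ldl /=.
have -> : all (fun x => logn x (l * d) == 1)%N (primes d) =
          all (fun x => logn x d == 1)%N (primes d).
  apply: eq_in_all => x; rewrite mem_primes => /and3P[x_pr _ xd].
  rewrite lognM ?(prime_gt0 l_pr) // logn_prime // (_ : x == l = false) //.
  by apply: contraNF ld => /eqP <-.
by case: ifP => _; rewrite ?oppr0 // exprS mulN1r.
Qed.

Lemma sum_moebius (k : nat) : (0 < k)%N ->
  \sum_(d <- divisors k) moebius d = (k == 1)%N%:R.
Proof.
move=> k0; have [->|k1] := eqVneq k 1%N; first by rewrite big_seq1.
have /pdivP[l l_pr lk] : (1 < k)%N by rewrite ltn_neqAle eq_sym k1.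
have l0 := prime_gt0 l_pr.
(* The divisors are split by [l]-adic valuation 0, 1 or more; the last kind contributes nothing. *)
rewrite (bigID (fun d => l %| d)%N) /= (bigID (fun d => 1 < logn l d)%N) /=.
rewrite big1 ?add0r => [|d /andP[_ /moebius_eq0] //].
(* d |-> l * d maps the divisors of k prime to l onto those of l-adic
   valuation 1, and changes the sign of moebius. *)
rewrite -big_filter; set s := filter _ _.
rewrite -[X in _ + X]big_filter; set t := filter _ _.
have perm_s : perm_eq s [seq (l * d)%N | d <- t].
  apply: uniq_perm; rewrite ?filter_uniq ?divisors_uniq //.
    rewrite map_inj_uniq ?filter_uniq ?divisors_uniq // => x y /eqP.
    by rewrite eqn_pmul2l // => /eqP.
  move=> x; rewrite mem_filter -dvdn_divisors //.
  apply/idP/mapP => [/andP[/andP[/dvdnP[d ->] ldl] dk]|[d]].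
    exists d; last exact: mulnC.
    rewrite mem_filter -dvdn_divisors //.
    have d0 : (0 < d)%N by move: (dvdn_gt0 k0 dk); rewrite muln_gt0 => /andP[].
    rewrite (dvdn_trans _ dk) ?dvdn_mulr // andbT.
    apply: contra ldl => ld; rewrite lognM // (logn_prime _ l_pr) eqxx addn1 ltnS.
    by rewrite logn_gt0 mem_primes l_pr d0.
  rewrite mem_filter -dvdn_divisors // => /andP[ld dk] ->.
  have d0 : (0 < d)%N by apply: dvdn_gt0 dk.
  rewrite dvdn_mulr // lognM // (logn_prime _ l_pr) eqxx lognE (negPf ld).
  rewrite !andbF /=.
  by rewrite Gauss_dvd ?lk ?dk // prime_coprime.
rewrite (perm_big _ perm_s) big_map big_seq_cond.
rewrite [X in _ + X]big_seq_cond -big_split big1 // => d.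
rewrite mem_filter -dvdn_divisors // andbT => /andP[ld dk] /=.
by rewrite moebius_mul_prime ?addNr // (dvdn_gt0 k0).
Qed.

(** After exchanging the sums, [E c] is weighted by the [moebius d] with [d] and [n/(cd)] prime to
    [p] and product [n/c]. If [p] divides [n/c] there is no such [d]; otherwise all divisors of
    [n/c] occur and the weight is 1 or 0 as [c = n] or not. *)
Lemma moebius_inversion_coprime (R : comPzRingType) (p n : nat) (E : nat -> R) :
  prime p -> (0 < n)%N ->
  \sum_(d <- divisors n | ~~ (p %| d)%N) (moebius d)%:~R *
    (\sum_(c <- divisors (n %/ d) | ~~ (p %| n %/ d %/ c)%N) E c) = E n.
Proof.
move=> p_pr n0.
pose G d c := (moebius d)%:~R * E c.
transitivity (\sum_(d <- divisors n | ~~ (p %| d)%N)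
   \sum_(c <- divisors n | (c * d %| n)%N && ~~ (p %| n %/ d %/ c)%N) G d c).
  rewrite big_seq_cond [RHS]big_seq_cond; apply: eq_bigr => d.
  rewrite -dvdn_divisors // => /andP[dn pd].
  have d0 := dvdn_gt0 n0 dn.
  have nd0 : (0 < n %/ d)%N by rewrite divn_gt0 // dvdn_leq.
  rewrite mulr_sumr -big_filter -[RHS]big_filter; apply: perm_big.
  apply: uniq_perm; rewrite ?filter_uniq ?divisors_uniq // => c.
  rewrite !mem_filter -!dvdn_divisors // (dvdn_divRL _ dn).
  apply/andP/andP => [[-> cdn] | [/andP[cdn ->] _] //].
  by split; rewrite ?cdn ?(dvdn_trans _ cdn) ?dvdn_mulr.
rewrite (exchange_big_dep xpredT) //=.
transitivity (\sum_(c <- divisors n) E c * (c == n)%:R).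
  rewrite big_seq_cond [RHS]big_seq_cond; apply: eq_bigr => c.
  rewrite andbT -dvdn_divisors // => cn.
  have c0 := dvdn_gt0 n0 cn.
  have nc0 : (0 < n %/ c)%N by rewrite divn_gt0 // dvdn_leq.
  have <- : (n %/ c == 1)%N = (c == n).
    by rewrite -(eqn_pmul2r c0) divnK // mul1n eq_sym.
  have [pnc|pnc] := boolP (p %| n %/ c)%N.
    have -> : (n %/ c == 1)%N = false.
      apply: contraTF pnc => /eqP->.
      by rewrite dvdn1 gtn_eqF ?prime_gt1.
    rewrite mulr0 big1_seq // => d.
    case/andP=> /and3P[pd /dvdnP[k Dn] pnd] _; case/negP: pnd.
    have d0 : (0 < d)%N by move: n0; rewrite Dn !muln_gt0 => /and3P[].
    have -> : (n %/ d %/ c = k)%N.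
      by rewrite -divnMA [(d * c)%N]mulnC Dn mulnK // muln_gt0 c0.
    move: pnc; rewrite Dn mulnCA mulKn //.
    by rewrite Euclid_dvdM // (negPf pd) orbF.
  rewrite -(rmorph_nat (intmul 1)) -(sum_moebius nc0) rmorph_sum mulr_sumr.
  under [RHS]eq_bigr do rewrite mulrC.
  rewrite -big_filter; apply: perm_big.
  apply: uniq_perm; rewrite ?filter_uniq ?divisors_uniq // => d.
  rewrite mem_filter -!dvdn_divisors //.
  apply/andP/idP => [[/and3P[_ cdn _] _] | dnc].
    by rewrite dvdn_divRL // mulnC.
  have cdn : (c * d %| n)%N by rewrite mulnC -dvdn_divRL.
  have dn : (d %| n)%N by apply: dvdn_trans cdn; apply: dvdn_mull.
  split=> //; rewrite cdn andTb -negb_or.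
  apply: contra pnc => /orP[pd|]; first exact: dvdn_trans dnc.
  by rewrite -divnMA mulnC divnMA => /dvdn_trans; apply; apply: dvdn_div.
rewrite (bigD1_seq n) ?divisors_uniq -?dvdn_divisors //= eqxx mulr1.
by rewrite big1 ?addr0 // => c /negPf->; rewrite mulr0.
Qed.

(** * Traces as multiples of orbit sums *)

Lemma sum_iter_order (T : finType) (V : nmodType) (f : T -> T) (g : T -> V)
    (x : T) (k : nat) : injective f ->
  \sum_(i < k * fingraph.order f x) g (iter i f x) =
    (\sum_(y <- fingraph.orbit f x) g y) *+ k.
Proof.
move=> f_inj; set d := fingraph.order f x.
have orbE : \sum_(y <- fingraph.orbit f x) g y = \sum_(i < d) g (iter i f x).
  rewrite /fingraph.orbit -/d.
  elim: d => [|d IH]; first by rewrite big_nil big_ord0.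
  by rewrite trajectSr big_rcons big_ord_recr /= IH.
rewrite orbE; elim: k => [|k IH]; first by rewrite big_ord0.
(* One turn around the orbit is split off; by injectivity the remaining turns start again at [x]. *)
rewrite mulSn big_split_ord mulrS /=; congr (_ + _).
rewrite -IH; apply: eq_bigr => i _; rewrite addnC iterD.
by rewrite iter_order.
Qed.

(** This is the logarithmic derivative at 0, with denominators cleared. *)
Lemma coef1_prod_XsubC (K : fieldType) (s : seq K) : 0 \notin s ->
  (\prod_(x <- s) ('X - x%:P))`_1 =
  - (\prod_(x <- s) ('X - x%:P))`_0 * \sum_(x <- s) x^-1.
Proof.
elim: s => [|a s IH]; first by rewrite !big_nil mulr0 coef1.
rewrite inE negb_or eq_sym => /andP[a0 /IH {}IH]; rewrite !big_cons.
rewrite !mulrBl !coefB !coefXM !coefCM /= sub0r IH opprK mulrDr mulrAC mulfV //.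
by rewrite mul1r mulNr mulrN opprK mulrA.
Qed.

Section MinpTrace.

Variables (F L : finFieldType) (iota : {rmorphism F -> L}).
Local Notation fr := (frob iota).

(* The second condition is waived in degree 1, where f`_1 = 1: the first one
   then reads f = 'X, whose root 0 has rTr 0 = 0 because 0^-1 = 0. *)
Definition tr0_poly (d : nat) (f : {poly F}) :=
  (f`_d.-1 == 0) && ((f`_1 == 0) || (d == 1)%N).

Lemma tr0_poly_minp (a : L) :
  tr0_poly (fingraph.order fr a) (minp iota a) =
  (\sum_(x <- fingraph.orbit fr a) x == 0) &&
  (\sum_(x <- fingraph.orbit fr a) x^-1 == 0).
Proof.
rewrite /tr0_poly; set d := fingraph.order fr a.
have coefE i : ((minp iota a)`_i == 0) = ((orbit_poly iota a)`_i == 0).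
  by rewrite -map_minp coef_map fmorph_eq0.
rewrite !coefE.
have ->: ((orbit_poly iota a)`_d.-1 == 0) =
         (\sum_(x <- fingraph.orbit fr a) x == 0).
  rewrite /d -size_orbit coefPn_prod_XsubC ?oppr_eq0 //.
  by rewrite size_orbit -lt0n fingraph.order_gt0.
have [d1|d_neq1] := eqVneq d 1%N.
  by rewrite orbT andbT /fingraph.orbit -/d d1 /= !big_seq1 invr_eq0 andbb.
rewrite orbF; congr (_ && _).
(* If the orbit met 0, a power of [a] would vanish, so [a = 0], whose orbit has length 1. *)
have o0 : 0 \notin fingraph.orbit fr a.
  apply: contra d_neq1; rewrite -fconnect_orbit => /iter_findex.
  rewrite iter_frob => /eqP; rewrite expf_eq0 => /andP[_ /eqP a0].
  rewrite -dvdn1; apply: order_dvdn_iter.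
  by rewrite a0 /= rmorph0.
rewrite coef1_prod_XsubC // mulf_eq0 oppr_eq0.
have /negPf-> // : (orbit_poly iota a)`_0 != 0.
by rewrite -horner_coef0 -/(root _ _) root_prod_XsubC.
Qed.

Variables (p m : nat).
Hypotheses (pF : p \in [pchar F]) (cardL : #|L| = (#|F| ^ m)%N).

Lemma trace0_minp (a : L) (d := fingraph.order fr a) :
  (\sum_(i < m) a ^+ (#|F| ^ i) == 0) && (\sum_(i < m) a ^- (#|F| ^ i) == 0) =
  (p %| m %/ d)%N || tr0_poly d (minp iota a).
Proof.
have pL : p \in [pchar L] by rewrite (fmorph_pchar iota).
have /dvdnP[k Dm] := frob_order_dvd iota cardL a.
rewrite tr0_poly_minp /d Dm mulnK ?fingraph.order_gt0 //.
have inj := @frob_inj F L iota.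
have -> : \sum_(i < k * fingraph.order fr a) a ^+ (#|F| ^ i) =
    (\sum_(x <- fingraph.orbit fr a) x) *+ k.
  by rewrite -(sum_iter_order id) //; apply: eq_bigr => i _; rewrite iter_frob.
have -> : \sum_(i < k * fingraph.order fr a) a ^- (#|F| ^ i) =
    (\sum_(x <- fingraph.orbit fr a) x^-1) *+ k.
  rewrite -(sum_iter_order GRing.inv) //.
  by apply: eq_bigr => i _; rewrite iter_frob.
(* Both sums now carry the factor [k%:R], which vanishes in characteristic [p] iff [p] divides
   [k = m/d]. *)
rewrite -[X in (X == 0) && _]mulr_natr -[X in _ && (X == 0)]mulr_natr.
rewrite !mulf_eq0 -(dvdn_pcharf pL).
by case: (p %| k)%N; rewrite ?orbT ?orbF.
Qed.

End MinpTrace.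

(** * Counting field elements by degree *)

(** The factor [d] turns a count of polynomials into a count of their roots. *)
Definition irr_root_count (F : finFieldType) (d : nat) (Q : pred {poly F}) :=
  (d * #|[set f : {poly_d.+1 F} |
      [&& size f == d.+1, (f : {poly F}) \is monic, irreducibleb f & Q f]]|)%N.

Lemma card_minp_order (F L : finFieldType) (iota : {rmorphism F -> L})
    (m : nat) (Q : nat -> pred {poly F}) :
  #|L| = (#|F| ^ m)%N -> (0 < m)%N ->
  #|[set a : L | Q (fingraph.order (frob iota) a) (minp iota a)]| =
  (\sum_(d <- divisors m) irr_root_count d (Q d))%N.
Proof.
move=> cardL m0; set A := [set a | _].
transitivity
  (\sum_(a in A) \sum_(d <- divisors m | fingraph.order (frob iota) a == d) 1)%N.
  rewrite -sum1_card; apply: eq_bigr => a _; rewrite sum1_count.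
  rewrite (@eq_count _ _ (pred1 (fingraph.order (frob iota) a))).
    rewrite count_uniq_mem ?divisors_uniq // -dvdn_divisors //.
    by rewrite (frob_order_dvd iota cardL).
  by move=> d; rewrite /= eq_sym.
rewrite (exchange_big_dep xpredT) //= big_seq [RHS]big_seq.
apply: eq_bigr => d; rewrite -dvdn_divisors // => dm.
rewrite sum1_card /irr_root_count -(card_minp_pred iota cardL _ dm).
apply: eq_card => a; rewrite [LHS]unfold_in /= !inE andbC.
by case: eqP => // ->.
Qed.

(** Every element of the extension has one minimal polynomial; used below with [m/p] in place of
    [m]. *)
Lemma sum_irr_root_count (F : finFieldType) (m : nat) : (0 < m)%N ->
  (\sum_(d <- divisors m) irr_root_count d (@predT {poly F}))%N = (#|F| ^ m)%N.
Proof.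
move=> m0; rewrite -(card_finExt F m0).
pose iota : {rmorphism F -> finvect_type (finExt F m)} := in_alg (finExt F m).
rewrite -(@card_minp_order F (finvect_type (finExt F m)) iota m (fun=> predT)) //.
  by apply: eq_card => a; rewrite inE.
exact: card_finExt.
Qed.

Lemma Fcount00E (F : finFieldType) (p m : nat) : p \in [pchar F] -> (0 < m)%N ->
  Fcount m (0 : F) 0 =
  (\sum_(d <- divisors m | ~~ (p %| m %/ d)%N) irr_root_count d (@tr0_poly F d)
   + (p %| m)%N * #|F| ^ (m %/ p))%N.
Proof.
move=> pF m0; set L := finvect_type (finExt F m).
have p_pr := pcharf_prime pF; have p0 := prime_gt0 p_pr.
pose iota : {rmorphism F -> L} := in_alg (finExt F m).
have cardL : #|L| = (#|F| ^ m)%N by exact: card_finExt.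
transitivity (#|[set a : L | (p %| m %/ fingraph.order (frob iota) a)%N
    || tr0_poly (fingraph.order (frob iota) a) (minp iota a)]|).
  apply: eq_card => a; rewrite !inE -(trace0_minp iota pF cardL).
  by rewrite !scale0r.
rewrite (@card_minp_order F L iota m
  (fun d f => (p %| m %/ d)%N || tr0_poly d f)) //.
rewrite (bigID (fun d => p %| m %/ d)%N) /= addnC; congr (_ + _)%N.
  by apply: eq_bigr => d /negPf pd; rewrite pd.
have [pm|pm] := boolP (p %| m)%N; last first.
  rewrite mul0n big_seq_cond big1 // => d; rewrite -dvdn_divisors //.
  case/andP=> dm pd; case/negP: pm; apply: dvdn_trans pd _.
  by rewrite dvdn_divLR ?(dvdn_gt0 m0) // dvdn_mulr.
have mp0 : (0 < m %/ p)%N by rewrite divn_gt0 // dvdn_leq.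
rewrite mul1n -sum_irr_root_count //.
transitivity (\sum_(d <- divisors m | (p %| m %/ d)%N)
  irr_root_count d (@predT {poly F}))%N.
  by apply: eq_bigr => d pd; rewrite pd.
(* The two index sets agree: for [d | m], [p | m/d] iff [d | m/p]. *)
rewrite -big_filter; apply: perm_big.
apply: uniq_perm; rewrite ?filter_uniq ?divisors_uniq // => d.
rewrite mem_filter -!dvdn_divisors //.
apply/andP/idP => [[pd dm]|].
  by move: pd; rewrite !dvdn_divRL // mulnC.
rewrite dvdn_divRL // => dpm.
have dm : (d %| m)%N by apply: dvdn_trans dpm; rewrite dvdn_mulr.
by rewrite dm dvdn_divRL // mulnC.
Qed.

(** * The formula in degree [n] *)

Lemma Ibar00E (F : finFieldType) (n : nat) : (2 <= n)%N ->
  irr_root_count n (@tr0_poly F n) = (n * Ibar00 F n)%N.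
Proof.
move=> n2; rewrite /irr_root_count /Ibar00; congr (_ * _)%N.
apply: eq_card => f; rewrite !inE /tr0_poly.
by rewrite (gtn_eqF n2) orbF.
Qed.

Theorem theorem1 (p r q : nat) (F : finFieldType) (n : nat) :
  prime p -> q = (p ^ r)%N -> #|F| = q -> (2 <= n)%N ->
  (Ibar00 F n)%:R =
    n%:R^-1 *
    \sum_(d <- divisors n | ~~ (p %| d)%N)
      (moebius d)%:~R *
      ((Fcount (n %/ d)%N (0 : F) 0)%:R
        - (p %| n)%N%:R * q%:R ^+ (n %/ (p * d))%N) :> rat.
Proof.
move=> p_pr -> cardF n2.
have n0 : (0 < n)%N by apply: leq_trans n2.
have pF : p \in [pchar F] by apply: card_finPcharP cardF p_pr.
pose E c : rat := (irr_root_count c (@tr0_poly F c))%:R.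
have En : E n = n%:R * (Ibar00 F n)%:R by rewrite /E Ibar00E // natrM.
have nn0 : n%:R != 0 :> rat by rewrite Num.Theory.pnatr_eq0 -lt0n.
(* Clearing [n] leaves [E n], which is expanded by inversion and compared term by term. *)
apply: (mulfI nn0); rewrite mulrA mulfV // mul1r -En.
rewrite -(moebius_inversion_coprime E p_pr n0).
rewrite big_seq_cond [RHS]big_seq_cond; apply: eq_bigr => d.
rewrite -dvdn_divisors // => /andP[dn pd]; congr (_ * _).
have d0 := dvdn_gt0 n0 dn.
have nd0 : (0 < n %/ d)%N by rewrite divn_gt0 // dvdn_leq.
rewrite (Fcount00E pF nd0) natrD natr_sum natrM natrX cardF.
(* Since [p] does not divide [d], passing to [n/d] keeps the indicator. *)
have -> : (p %| n %/ d)%N = (p %| n)%N.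
  by rewrite -[in RHS](divnK dn) Euclid_dvdM // (negPf pd) orbF.
by rewrite -divnMA [(d * p)%N]mulnC addrK.
Qed.
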